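(* Let $0<r_1<r_2$, $0<p<1$, and let $v_1,v_2\neq0$, $b_1,b_2$ be real constants. Suppose $(\gamma_n)$, $(\alpha_n)$ are sequences with $\gamma_n\sim v_0\frac{\exp(r_0n^p)}{n^{b_0}}$ for some constants $v_0\neq 0$, $r_0>0$, $b_0$, and $\alpha_n\sim v_1\frac{\exp(r_1n^p)}{n^{b_1}}$, and that the convolution $c_n=\sum_{k=0}^n\gamma_{n-k}\alpha_k$ satisfies $c_n\sim v_2\frac{\exp(r_2n^p)}{n^{b_2}}$. Then $$r_0=\left(r_2^{\frac1{1-p}}-r_1^{\frac1{1-p}}\right)^{1-p},\qquad b_0=b_2-b_1-\frac p2+1,$$ $$v_0=\frac{\sqrt{(1-p)p}\;v_2\,r_2^{\frac{1-2b_2}{2(1-p)}}\left(r_2^{\frac1{1-p}}-r_1^{\frac1{1-p}}\right)^{b_2-b_1-\frac p2+\frac12}}{\sqrt{2\pi}\,v_1\,r_1^{\frac{1-2b_1}{2(1-p)}}}.$$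
   Context: For sequences $x_n,y_n$, $x_n\sim y_n$ means $x_n/y_n\to 1$ as $n\to\infty$. *)

(* Defs.v *)
From HB Require Import structures.
From mathcomp Require Import all_boot all_order all_algebra.
From mathcomp Require Import all_classical all_reals all_analysis.

Set Implicit Arguments.
Unset Strict Implicit.
Unset Printing Implicit Defensive.

Import Order.TTheory GRing.Theory Num.Theory.
Import numFieldNormedType.Exports.

Local Open Scope classical_set_scope.
Local Open Scope ring_scope.

(* Division by zero yields 0, so [seq_equiv x y] forces [y n != 0] for all
   large [n]; finitely many terms, in particular the one at [0], do not
   matter. *)
Definition seq_equiv (R : realType) (x y : nat -> R) : Prop :=
  (fun n => x n / y n) @ \oo --> (1 : R).

Definition exp_pow (R : realType) (p v r b : R) (n : nat) : R :=
  v * (expR (r * n%:R `^ p) / n%:R `^ b).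

Definition seq_convolution (R : realType) (x y : nat -> R) (n : nat) : R :=
  \sum_(k < n.+1) x (n - k)%N * y k.

(* Main.v *)
Require Import Defs.
From HB Require Import structures.
From mathcomp Require Import all_boot all_order all_algebra.
From mathcomp Require Import all_classical all_reals all_analysis.
From mathcomp Require Import measurable_realfun ring lra.

Set Implicit Arguments.
Unset Strict Implicit.
Unset Printing Implicit Defensive.

Import Order.TTheory GRing.Theory Num.Theory.
Import numFieldNormedType.Exports.

Local Open Scope classical_set_scope.
Local Open Scope ring_scope.

(** By Laplace's method, the convolution of [v0 exp(r0 n^p) / n^b0] and
    [v1 exp(r1 n^p) / n^b1] has asymptotics of the same shape; comparing them
    with the assumed ones determines [r0], [b0] and [v0].

    The exponent [r0 (n-k)^p + r1 k^p] is maximal near [k = lam n] with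
    [lam = s1 / (s0 + s1)], [si = ri^(1/(1-p))].  With [rho = (s0 + s1)^(1-p)]
    one has [r0 = rho (1-lam)^(1-p)] and [r1 = rho lam^(1-p)], so the exponent is
    [rho n^p ((1-lam) u^p + lam t^p)] with [t = k/(lam n)],
    [u = (n-k)/((1-lam) n)] and [(1-lam) u + lam t = 1]: the expansion of
    [x^p] at [x = 1] has no first-order contribution.  Hence the maximum is
    [rho n^p] and the terms decay like a Gaussian of width [n^(1-p/2)].  The
    rescaled sum is the integral of a step function, to which dominated
    convergence and the Gaussian integral apply. *)

(** * Power functions *)

Section powR_estimates.
Variable R : realType.
Implicit Types (a b c p t x y : R) (n k : nat).

Lemma cvg_powR_pos {T : Type} (F : set_system T) {FF : Filter F} (f : T -> R) x a :
  0 < x -> f @ F --> x -> (fun i => f i `^ a) @ F --> x `^ a.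
Proof.
move=> x0 fx.
have d : derivable (fun y : R => y `^ a) x 1.
  by apply: derivable_powR; rewrite in_itv /= x0.
apply: (@continuous_cvg _ _ _ F FF f (fun y : R => y `^ a) x) => //.
exact/differentiable_continuous/derivable1_diffP.
Qed.

Lemma powR_div x y a : 0 <= x -> 0 <= y -> (x / y) `^ a = x `^ a / y `^ a.
Proof.
move=> x0 y0; rewrite powRM ?invr_ge0//; congr (_ * _).
by rewrite -powR_inv1// -powRrM mulN1r powRN.
Qed.

Lemma cvg_natr_powR a : 0 < a -> (fun n => n%:R `^ a : R) @ \oo --> +oo.
Proof.
move=> a0; apply/cvgryPge => A.
have [B [B0 AB]] : exists B : R, 0 < B /\ A <= B.
  by exists (Num.max A 1); rewrite lt_max ltr01 orbT le_max lexx.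
have h := (cvgryPge (fun n : nat => n%:R : R)).1 cvgr_idn (B `^ a^-1).
near=> n; have hn : B `^ a^-1 <= n%:R by near: n; exact: h.
apply: (le_trans AB).
have -> : B = (B `^ a^-1) `^ a by rewrite -powRrM mulVf ?gt_eqF// powRr1 ?ltW.
by apply: ge0_ler_powR => //; rewrite ?nnegrE ?powR_ge0 // ltW.
Unshelve. all: by end_near. Qed.

(** Leaving the order of the endpoints open lets a Taylor expansion at 1 treat points on both sides
    of 1 at once. *)
Lemma rolle_pos (f df : R -> R) a b : 0 < a -> 0 < b -> a != b ->
  (forall x, 0 < x -> is_derive x 1 f (df x)) -> f a = f b ->
  exists2 c, Num.min a b < c < Num.max a b & df c = 0.
Proof.
wlog ab : a b / a < b.
  move=> H a0 b0 ne fd fab; have [ab|ba|] := ltgtP a b; last by move/eqP: ne.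
  - by have := H a b ab a0 b0 ne fd fab; rewrite min_l ?max_r ?ltW.
  - have := H b a ba b0 a0; rewrite eq_sym min_l ?max_r ?ltW//; exact.
move=> a0 b0 _ fd fab; rewrite min_l ?max_r ?ltW//.
have fd' x : x \in `[a, b] -> derivable f x 1.
  rewrite in_itv /= => /andP[ax _].
  by have [] := fd x (lt_le_trans a0 ax).
have fcont : {within `[a, b], continuous f}.
  by apply: derivable_within_continuous => x; exact: fd'.
have fdo x : x \in `]a, b[ -> derivable f x 1.
  by move=> /subset_itv_oo_cc; exact: fd'.
have [c cab dc] := Rolle ab fdo fcont fab.
exists c; first by move: cab; rewrite in_itv.
have c0 : 0 < c by rewrite (lt_trans a0)// (itvP cab).
have [_ <-] := fd c c0.
by have [] := dc.
Qed.

(** Rolle is applied twice: [G] vanishes at 1 and [t], so [dG] vanishes at some [c] between them as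
    well as at 1, hence [ddG] vanishes at some [xi], which identifies [K]. *)
Lemma powR_taylor2 p t : 0 < t -> t != 1 ->
  exists2 xi, Num.min 1 t < xi < Num.max 1 t &
    t `^ p = 1 + p * (t - 1) - p * (1 - p) / 2 * xi `^ (p - 2) * (t - 1) ^+ 2.
Proof.
move=> t0 t1; have tB : t - 1 != 0 by rewrite subr_eq0.
(* [K] is the coefficient of the quadratic remainder, fixed by requiring [G t = 0] below. *)
pose K := (t `^ p - 1 - p * (t - 1)) / (t - 1) ^+ 2.
have KE : t `^ p = 1 + p * (t - 1) + K * (t - 1) ^+ 2.
  by rewrite /K; field.
pose G (s : R) : R := s `^ p - 1 - p * (s - 1) - K * (s - 1) ^+ 2.
pose dG (s : R) : R := p * s `^ (p - 1) - p - K * (2 * (s - 1)).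
pose ddG (s : R) : R := p * ((p - 1) * s `^ (p - 2)) - K * 2.
have dGP (s : R) : 0 < s -> is_derive s 1 G (dG s).
  move=> s0; have dp := is_derive1_powR p s0; rewrite /G.
  by apply: is_derive_eq; rewrite /dG /GRing.scale /=; ring.
have ddGP (s : R) : 0 < s -> is_derive s 1 dG (ddG s).
  move=> s0; have dp := is_derive1_powR (p - 1) s0; rewrite /dG.
  apply: is_derive_eq; rewrite /ddG /GRing.scale /=.
  by rewrite (_ : p - 1 - 1 = p - 2); ring.
have t1' : 1 != t by rewrite eq_sym.
have G1t : G 1 = G t by rewrite /G powR1 KE; ring.
have [c /andP[c1 c2] dc] := rolle_pos ltr01 t0 t1' dGP G1t.
have cp : 0 < c by apply: lt_trans c1; rewrite lt_min ltr01.
have c1' : 1 != c.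
  by apply/eqP => cE; move: c1 c2; rewrite -cE gt_min lt_max ltxx /=; lra.
have dG1c : dG 1 = dG c by rewrite dc /dG powR1; ring.
have [xi /andP[x1 x2] dx] := rolle_pos ltr01 cp c1' ddGP dG1c.
exists xi.
  move: c1 c2 x1 x2; rewrite !gt_min !lt_max.
  case: (ltP 1 c) => h1; case: (ltP 1 t) => h2 //=; rewrite ?orbF ?orbT ?andbT; lra.
rewrite KE; congr (_ + _).
have -> : K = p * (p - 1) / 2 * xi `^ (p - 2).
  by move: dx; rewrite /ddG => dx; lra.
ring.
Qed.

(** Concavity: for [0 < p < 1] the Taylor remainder is nonpositive. *)
Lemma powR_le_tangent p t : 0 < p < 1 -> 0 <= t -> t `^ p <= 1 + p * (t - 1).
Proof.
move=> /andP[p0 p1]; rewrite le_eqVlt => /orP[/eqP <-|t0].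
  by rewrite powR0 ?gt_eqF//; lra.
have [->|t1] := eqVneq t 1; first by rewrite powR1; lra.
have [xi _ ->] := powR_taylor2 p t0 t1.
rewrite lerBlDr lerDl mulr_ge0 ?sqr_ge0// mulr_ge0 ?powR_ge0//; nra.
Qed.

(** Since [p - 2 < 0], the intermediate point [xi <= T] gives [xi^(p-2) >= T^(p-2)], which makes the
    quadratic loss uniform up to [T]. *)
Lemma powR_le_parabola p T t : 0 < p < 1 -> 1 <= T -> 0 <= t <= T ->
  t `^ p <= 1 + p * (t - 1) - p * (1 - p) / 2 * T `^ (p - 2) * (t - 1) ^+ 2.
Proof.
move=> /andP[p0 p1] T1 /andP[]; rewrite le_eqVlt => /orP[/eqP <- _|t0 tT].
  (* The Taylor formula excludes [t = 0]; there the claim reduces to [(1 - p) * (1 - p / 2) >= 0]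
     once [T^(p-2)] is bounded by 1. *)
  have T2 : T `^ (p - 2) <= 1.
    by rewrite -[leRHS](@powRr0 _ T) ler_powR//; lra.
  have q0 : 0 <= p * (1 - p) / 2 by nra.
  have := ler_wpM2l q0 T2; rewrite powR0 ?gt_eqF//; nra.
have [->|t1] := eqVneq t 1; first by rewrite powR1; lra.
have [xi /andP[x1 x2] ->] := powR_taylor2 p t0 t1.
have x0 : 0 < xi by apply: lt_trans x1; rewrite lt_min ltr01.
have xT : xi <= T by move: x2; rewrite lt_max => /orP[]; lra.
rewrite lerB// ler_wpM2r ?sqr_ge0// ler_wpM2l//; first nra.
rewrite (_ : p - 2 = - (2 - p)); last by ring.
rewrite !powRN lef_pV2 ?posrE ?powR_gt0//; last lra.
by apply: ge0_ler_powR => //; rewrite ?nnegrE; lra.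
Qed.

End powR_estimates.

(** * Growth [exp(r n^p) / n^b] *)

Section growth.
Variable R : realType.
Implicit Types (a b c p r : R) (n k : nat).

(** Apply [ln z < z] to [z = eta * (n+1)^p]. The choice of [eta] turns the bound
    [(n+1)^p <= 2^p * n^p + 1], whose last term covers [n = 0], into the coefficient [eps]. *)
Lemma ln_natr_le p eps : 0 < p -> 0 < eps ->
  exists C, forall n, ln (n.+1%:R : R) <= eps * n%:R `^ p + C.
Proof.
move=> p0 e0; pose eta : R := eps * p / 2 `^ p.
have two0 : 0 < 2 `^ p :> R by rewrite powR_gt0.
have eta0 : 0 < eta by rewrite /eta !mulr_gt0 ?invr_gt0.
exists ((eta - ln eta) / p) => n.
have n1 : 0 < n.+1%:R `^ p :> R by rewrite powR_gt0.
have : ln (eta * n.+1%:R `^ p) < eta * n.+1%:R `^ p.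
  by apply: ln_sublinear; rewrite mulr_gt0.
rewrite lnM ?posrE// ln_powR => lnlt.
have np : n.+1%:R `^ p <= 2 `^ p * n%:R `^ p + 1 :> R.
  case: n {lnlt n1} => [|n].
    by rewrite powR1 lerDr mulr_ge0 ?powR_ge0.
  have n2 : n.+2%:R <= 2 * n.+1%:R :> R.
    by rewrite -natrM ler_nat mul2n -addnn addSn ltnS leq_addl.
  rewrite -powRM// (@le_trans _ _ ((2 * n.+1%:R) `^ p)) ?lerDl//.
  by apply: ge0_ler_powR; rewrite ?nnegrE ?(ltW p0) ?mulr_ge0.
have := ler_wpM2l (ltW eta0) np; rewrite mulrDr mulr1 mulrA.
rewrite (_ : eta * 2 `^ p = eps * p); last first.
  by rewrite /eta divfK ?gt_eqF.
move=> etan; rewrite -(ler_pM2l p0) mulrDr (mulrC p (_ / p)) divfK ?gt_eqF//.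
lra.
Qed.

Lemma natr_powR_le_expR p b c : 0 < p -> 0 < c ->
  exists2 C, 0 < C & forall n, n.+1%:R `^ b <= C * expR (c * n%:R `^ p).
Proof.
(* Using [|b| + 1] instead of [|b|] keeps the divisor positive when [b = 0]. *)
move=> p0 c0; have b0 : 0 < `|b| + 1 by rewrite ltr_wpDl.
have [|C hC] := @ln_natr_le p (c / (`|b| + 1)) p0; first by rewrite divr_gt0.
exists (expR ((`|b| + 1) * C)) => [|n]; first exact: expR_gt0.
rewrite /powR pnatr_eq0 /= -/(powR _ _) -expRD ler_expR.
have ln0 : 0 <= ln n.+1%:R :> R by rewrite ln_ge0// ler1n.
apply: (@le_trans _ _ ((`|b| + 1) * ln n.+1%:R)).
  by rewrite ler_wpM2r// (le_trans (ler_norm b))// lerDl.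
have := ler_wpM2l (ltW b0) (hC n).
rewrite mulrDr mulrA (mulrC _ (c / _)) divfK ?gt_eqF//; lra.
Qed.

(* [n.+1] in the denominator avoids the junk value at [n = 0]. *)
Definition growth p r b n : R := expR (r * n%:R `^ p) / n.+1%:R `^ b.

Lemma growth_gt0 p r b n : 0 < growth p r b n.
Proof. by rewrite /growth divr_gt0 ?expR_gt0 ?powR_gt0. Qed.

Lemma cvgn_succ_ratio : (fun n => n.+1%:R / n%:R : R) @ \oo --> (1 : R).
Proof.
rewrite -[X in _ --> X]addr0.
apply: (@cvg_trans _ ((fun n => 1 + n%:R^-1 : R) @ \oo)).
  apply: near_eq_cvg; near=> n.
  have n0 : (0 < n)%N by near: n; exact: nbhs_infty_gt.
  by rewrite /= -natr1 mulrDl divff ?mul1r// pnatr_eq0 -lt0n.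
apply: cvgD; first exact: cvg_cst.
apply/cvgrVy; last first.
  apply: cvg_trans (@cvgr_idn R); apply: near_eq_cvg; apply: nearW => n.
  by rewrite /= invrK.
by near=> n; rewrite invr_gt0 ltr0n; near: n; exact: nbhs_infty_gt.
Unshelve. all: by end_near. Qed.

(** Replacing [n^b] by [(n+1)^b] costs the factor [((n+1)/n)^b], which tends to 1. *)
Lemma seq_equiv_growth p v r b (x : nat -> R) : v != 0 ->
  seq_equiv x (exp_pow p v r b) -> (fun n => x n / growth p r b n) @ \oo --> v.
Proof.
move=> v0 xE.
have -> : v = 1 * v * 1 `^ b by rewrite powR1 mulr1 mul1r.
apply: (@cvg_trans _
    ((fun n => x n / exp_pow p v r b n * v * (n.+1%:R / n%:R) `^ b) @ \oo)).
  apply: near_eq_cvg; near=> n.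
  have n0 : (0 < n)%N by near: n; exact: nbhs_infty_gt.
  have nb0 : n%:R `^ b != 0 by rewrite gt_eqF// powR_gt0// ltr0n.
  have nb1 : n.+1%:R `^ b != 0 by rewrite gt_eqF// powR_gt0// ltr0n.
  rewrite /growth /exp_pow powR_div//.
  have e0 : expR (r * n%:R `^ p) != 0 by rewrite gt_eqF ?expR_gt0.
  by field; rewrite v0 nb0 nb1 e0.
apply: cvgM; first by apply: cvgM => //; exact: cvg_cst.
by apply: cvg_powR_pos => //; exact: cvgn_succ_ratio.
Unshelve. all: by end_near. Qed.

Lemma cvgn_normr_bounded (u : nat -> R) (l : R) : u @ \oo --> l ->
  exists M, forall n, `|u n| <= M.
Proof.
move=> ul; have : cvgn u by apply/cvg_ex; exists l.
move=> /cvg_seq_bounded[M [_ uM]]; exists (M + 1) => n.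
by apply: uM => //; rewrite ltrDl.
Qed.

(** The logarithm [u] of the ratio converges, hence is bounded. As [n^p] dominates [ln (n+1)], first
    [r = r']; then the unboundedness of [ln (n+1)] forces [b = b']. *)
Lemma growth_exponents_unique p r r' b b' (l : R) : 0 < p -> l != 0 ->
  (fun n => growth p r b n / growth p r' b' n) @ \oo --> l -> r = r' /\ b = b'.
Proof.
move=> p0 l0 gl.
pose u n : R := (r - r') * n%:R `^ p + (b' - b) * ln n.+1%:R.
have uE n : growth p r b n / growth p r' b' n = expR (u n).
  rewrite /growth /u /powR !pnatr_eq0 /= -/(powR _ _) -!expRB; congr expR; ring.
have lp : 0 < l.
  rewrite lt_neqAle eq_sym l0 -(cvg_lim _ gl)//.
  apply: limr_ge; first by apply/cvg_ex; exists l.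
  by apply: nearW => n; rewrite uE expR_ge0.
have ucvg : u @ \oo --> ln l.
  have : (@ln R \o (fun n => growth p r b n / growth p r' b' n)) @ \oo --> ln l.
    by apply: continuous_cvg => //; exact: continuous_ln.
  by apply: cvg_trans; apply: near_eq_cvg; apply: nearW => n /=; rewrite uE expRK.
have [M uM] : exists M, forall n, `|u n| <= M.
  exact: cvgn_normr_bounded ucvg.
have rr' : r = r'.
  apply/eqP; rewrite -subr_eq0; apply/negPn/negP => d0.
  have dp : 0 < `|r - r'| by rewrite normr_gt0.
  have e0 : 0 < `|b' - b| + 1 by rewrite ltr_wpDl.
  (* With this [eps] the logarithmic term takes up at most half of [|r - r'| * n^p], up to a
     constant; the other half would then be bounded, by [K] after division. *)
  have [|C hC] := @ln_natr_le p (`|r - r'| / 2 / (`|b' - b| + 1)) p0.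
    by rewrite !divr_gt0.
  pose K := (M + (`|b' - b| + 1) * C) / (`|r - r'| / 2).
  have := (cvgryPgt _).1 (cvg_natr_powR p0) K.
  move=> /(_ _)/filter_ex[n]; rewrite ltNge => /negP; apply.
  rewrite /K ler_pdivlMr ?divr_gt0//.
  have ln0 : 0 <= ln n.+1%:R :> R by rewrite ln_ge0// ler1n.
  have h1 := ler_wpM2l (ltW e0) (hC n).
  rewrite mulrDr mulrA (mulrC _ (_ / _ / _)) divfK ?gt_eqF// in h1.
  have h2 : `|r - r'| * n%:R `^ p <= M + `|b' - b| * ln n.+1%:R.
    have -> : `|r - r'| * n%:R `^ p = `|u n - (b' - b) * ln n.+1%:R|.
      by rewrite /u addrK normrM (ger0_norm (powR_ge0 _ _)).
    rewrite (le_trans (ler_normB _ _))// lerD//.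
    by rewrite normrM (ger0_norm ln0).
  lra.
split=> //; apply/eqP; rewrite eq_sym -subr_eq0; apply/negPn/negP => e0.
have ep : 0 < `|b' - b| by rewrite normr_gt0.
have := (cvgryPgt _).1 (@cvgr_idn R) (expR (M / `|b' - b|)).
move=> /(_ _)/filter_ex[n]; rewrite ltNge => /negP; apply.
have := uM n; rewrite /u rr' subrr mul0r add0r normrM mulrC => h.
have ln0 : 0 <= ln n.+1%:R :> R by rewrite ln_ge0// ler1n.
rewrite (ger0_norm ln0) -ler_pdivlMr// in h.
apply: (@le_trans _ _ n.+1%:R); first by rewrite ler_nat.
by rewrite -[leLHS]lnK ?posrE// ler_expR.
Qed.

End growth.

(** * Riemann sums of Gaussian type *)

Section riemann_sum.
Variable R : realType.
Local Notation mu := (@lebesgue_measure R).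

(** The variance is [1 / (2 * k)]. Integrability and the value of the Gaussian integral are thus
    inherited from the normal density. *)
Lemma expR_sqr_normal_pdf (k : R) : 0 < k ->
  exists s : R, forall x : R,
    expR (- (k * x ^+ 2)) = Num.sqrt (pi / k) * normal_pdf 0 s x.
Proof.
move=> k0; exists (Num.sqrt (2 * k)^-1) => x.
have k20 : 0 < (2 * k)^-1 by rewrite invr_gt0 mulr_gt0.
have kpi : 0 < pi / k :> R by rewrite divr_gt0// pi_gt0.
rewrite normal_pdfE ?gt_eqF ?sqrtr_gt0// /normal_peak /normal_fun.
rewrite sqr_sqrtr ?ltW// subr0.
have -> : (2 * k)^-1 * pi *+ 2 = pi / k :> R by field; rewrite gt_eqF.
rewrite mulVKf ?gt_eqF ?sqrtr_gt0//; congr expR.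
by field; rewrite gt_eqF.
Qed.

Lemma integrable_expR_sqr (k : R) : 0 < k ->
  mu.-integrable setT (fun x : R => (expR (- (k * x ^+ 2)))%:E).
Proof.
move=> k0; have [s E] := expR_sqr_normal_pdf k0.
have -> : (fun x : R => (expR (- (k * x ^+ 2)))%:E) =
    (fun x => (Num.sqrt (pi / k))%:E * (normal_pdf 0 s x)%:E)%E.
  by apply/funext => x; rewrite E EFinM.
by apply: integrableZl => //; exact: integrable_normal_pdf.
Qed.

Lemma integral_expR_sqr (k : R) : 0 < k ->
  (\int[mu]_x (expR (- (k * x ^+ 2)))%:E = (Num.sqrt (pi / k))%:E)%E.
Proof.
move=> k0; have [s E] := expR_sqr_normal_pdf k0.
transitivity (\int[mu]_x ((Num.sqrt (pi / k))%:E * (normal_pdf 0 s x)%:E))%E.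
  by apply: eq_integral => x _; rewrite E EFinM.
rewrite integralZl//; last exact: integrable_normal_pdf.
by rewrite integral_normal_pdf mule1.
Qed.

(** The interval from [k] to [k+1] in the coordinate [y] with [x = m + s * y]: [m] is the centre and
    [s] the width of the Gaussian window. *)
Definition cell (m s : R) k : set R := `[(k%:R - m) / s, (k.+1%:R - m) / s[%classic.

Lemma in_cell (m s y : R) k : 0 < s ->
  (y \in cell m s k) = (k%:R <= m + s * y < k.+1%:R).
Proof.
move=> s0; rewrite /cell mem_setE in_itv /= ler_pdivrMr// ltr_pdivlMr//.
by rewrite lerBlDl ltrBrDl (mulrC y).
Qed.

Definition step (m s : R) (w : nat -> R) n (y : R) : R :=
  \sum_(k < n.+1) w k * \1_(cell m s k) y.

Lemma stepE (m s : R) (w : nat -> R) n y : 0 < s ->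
  step m s w n y = if 0 <= m + s * y < n.+1%:R
    then w (Num.truncn (m + s * y)) else 0.
Proof.
move=> s0; rewrite /step; case: ifPn => [/andP[z0 zn]|zn]; last first.
  rewrite big1// => k _; rewrite indicE in_cell//.
  case: (boolP (k%:R <= _ < _)) => [/andP[kz zk]|_]; last by rewrite mulr0.
  move/negP: zn; case; rewrite (le_trans _ kz)//=.
  by rewrite (lt_le_trans zk)// ler_nat.
have tn : (Num.truncn (m + s * y) < n.+1)%N by rewrite truncn_lt_nat.
rewrite (bigD1 (Ordinal tn))//= indicE in_cell// truncn_itv//= mulr1.
rewrite big1 ?addr0// => k kt; rewrite indicE in_cell//.
case: (boolP (k%:R <= _ < _)) => [kz|_]; last by rewrite mulr0.
by move/eqP: kt; case; apply/val_inj => /=; rewrite (truncn_def kz).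
Qed.

Lemma measurable_step (m s : R) (w : nat -> R) n :
  measurable_fun setT (step m s w n).
Proof.
apply: measurable_sum => k; apply: measurable_funM => //.
by apply: measurable_indic; exact: measurable_itv.
Qed.

Lemma integral_step (m s : R) (w : nat -> R) n : 0 < s ->
  (\int[mu]_y (step m s w n y)%:E = ((\sum_(k < n.+1) w k) / s)%:E)%E.
Proof.
move=> s0; rewrite /step.
under eq_integral do rewrite -sumEFin.
have ik (k : 'I_n.+1) : mu.-integrable setT (fun y => (w k * \1_(cell m s k) y)%:E).
  under eq_fun do rewrite EFinM.
  by apply: integrableZl => //; exact: integrable_indic_itv.
rewrite integral_sum// mulr_suml -sumEFin; apply: eq_bigr => k _.
under eq_integral do rewrite EFinM.
rewrite integralZl//; last exact: integrable_indic_itv.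
rewrite integral_indic //; last exact: measurable_itv.
rewrite /= setIT /cell lebesgue_measure_itv /= lte_fin.
rewrite ltr_pM2r ?invr_gt0// ltrD2r ltr_nat ltnSn.
by rewrite -EFinD -EFinM -natr1; congr (_ * _)%:E; field; rewrite gt_eqF.
Qed.

(** The quotient is the integral of the step function with value [w n j] on the [j]-th cell. The
    limit along arbitrary index sequences supplies pointwise convergence, and the last hypothesis
    places each fixed [y] eventually inside the range of the cells. *)
Lemma riemann_sum_gauss (w : nat -> nat -> R) (m s : nat -> R) (C c A k : R) :
  0 < c -> 0 < k -> (forall n, 1 <= s n) -> s @ \oo --> +oo ->
  (forall n j, (j <= n)%N ->
    `|w n j| <= C * expR (- (c * ((j%:R - m n) / s n) ^+ 2))) ->
  (forall (y : R) (j : nat -> nat), (forall n, (j n <= n)%N) ->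
    (fun n => ((j n)%:R - m n) / s n) @ \oo --> y ->
    (fun n => w n (j n)) @ \oo --> A * expR (- (k * y ^+ 2))) ->
  (forall y, \forall n \near \oo, 0 <= m n + s n * y < n.+1%:R) ->
  (fun n => (\sum_(j < n.+1) w n j) / s n) @ \oo --> A * Num.sqrt (pi / k).
Proof.
move=> c0 k0 s1 soo wdom wlim zlim.
have s0 n : 0 < s n by exact: lt_le_trans (s1 n).
have C0 : 0 <= C.
  have := le_trans (normr_ge0 _) (wdom 0 0 (leqnn 0)).
  by rewrite pmulr_lge0// expR_gt0.
pose f n y := (step (m n) (s n) (w n) n y)%:E.
(* Rounding [y] to the left end [yj] of its cell moves it by at most [1 / s n <= 1], so
   [y^2 / 2 <= yj^2 + 1]; hence the halved rate and the factor [expR c]. *)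
pose g y := (C * expR c * expR (- (c / 2 * y ^+ 2)))%:E.
pose l y := (A * expR (- (k * y ^+ 2)))%:E.
have c20 : 0 < c / 2 by rewrite divr_gt0.
have mf n : measurable_fun setT (f n).
  by apply/measurable_EFinP; exact: measurable_step.
have il : mu.-integrable setT l.
  rewrite /l; under eq_fun do rewrite EFinM.
  by apply: integrableZl => //; exact: integrable_expR_sqr.
have ig : mu.-integrable setT g.
  rewrite /g; under eq_fun do rewrite EFinM.
  by apply: integrableZl => //; exact: integrable_expR_sqr.
have trunc_near n y : 0 <= m n + s n * y ->
    y - (s n)^-1 <= ((Num.truncn (m n + s n * y))%:R - m n) / s n <= y.
  move=> z0; have /andP[t1 t2] := truncn_itv z0.
  rewrite -natr1 in t2; apply/andP; split; last first.
    by rewrite ler_pdivrMr// (mulrC y); lra.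
  by rewrite ler_pdivlMr// mulrBl mulVf ?gt_eqF// (mulrC y); lra.
have dom n y : (`|f n y| <= g y)%E.
  rewrite /f /g abse_EFin lee_fin stepE//; case: ifPn => [/andP[z0 zn]|_]; last first.
    by rewrite normr0 !mulr_ge0// expR_ge0.
  set j := Num.truncn _.
  have jn : (j <= n)%N by rewrite truncn_le_nat.
  apply: (le_trans (wdom n j jn)); rewrite -mulrA ler_wpM2l// -expRD ler_expR.
  have := trunc_near n y z0; rewrite -/j; set yj := (_ / _).
  have si : (s n)^-1 <= 1 by rewrite invf_le1.
  move=> /andP[y1 y2]; have dy : (y - yj) ^+ 2 <= 1.
    by rewrite -(expr1n _ 2) ler_pXn2r ?nnegrE//; lra.
  have : y ^+ 2 / 2 <= yj ^+ 2 + 1.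
    have := sqr_ge0 (2 * yj - y); nra.
  move=> /(ler_wpM2l (ltW c0)); lra.
have lim y : (f ^~ y) @ \oo --> l y.
  apply: cvg_EFin; first exact: nearW.
  (* The cap at [n] ensures [j n <= n] for every [n]; it has no effect once [y] lies in the range of
     the cells. *)
  pose j n := minn (Num.truncn (m n + s n * y)) n.
  have jE : \forall n \near \oo, step (m n) (s n) (w n) n y = w n (j n) /\
      y - (s n)^-1 <= ((j n)%:R - m n) / s n <= y.
    near=> n.
    have /andP[z0 zn] : 0 <= m n + s n * y < n.+1%:R by near: n; exact: zlim.
    have -> : j n = Num.truncn (m n + s n * y).
      by apply/minn_idPl; rewrite truncn_le_nat.
    by rewrite stepE// z0 zn; split => //; exact: trunc_near.
  have jy : (fun n => ((j n)%:R - m n) / s n) @ \oo --> y.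
    apply: (@squeeze_cvgr _ _ _ _ (fun n => y - (s n)^-1) (fun=> y)).
    - by apply: filterS jE => n [].
    - rewrite -[X in _ --> X]subr0; apply: cvgB; first exact: cvg_cst.
      apply/cvgrVy; first by apply: nearW => n; rewrite invr_gt0.
      apply: cvg_trans soo; apply: near_eq_cvg; apply: nearW => n.
      by rewrite /= invrK.
    - exact: cvg_cst.
  have jn n : (j n <= n)%N by exact: geq_minr.
  apply: cvg_trans (wlim y j jn jy).
  by apply: near_eq_cvg; apply: filterS jE => n [/= ->].
have aelim : {ae mu, forall y, setT y -> f ^~ y @ \oo --> l y}.
  by apply: aeW => y _; exact: lim.
have aedom : {ae mu, forall y n, setT y -> (`|f n y| <= g y)%E}.
  by apply: aeW => y n _; exact: dom.
have [_ _] :=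
  @dominated_convergence _ _ _ mu setT measurableT f l g mf (measurable_int _ il)
    aelim ig aedom.
rewrite /l; under eq_integral do rewrite EFinM.
rewrite integralZl//; last exact: integrable_expR_sqr.
rewrite integral_expR_sqr// -EFinM => /fine_cvg.
by apply: cvg_trans; apply: near_eq_cvg; apply: nearW => n /=; rewrite integral_step.
Unshelve. all: by end_near. Qed.

End riemann_sum.

(** * Uniform bounds on the exponent *)

Section laplace.
Variable R : realType.
Implicit Types (a b c lam p r y : R) (n k : nat).

Lemma growth_ratio p r r' r'' b b' n k : (k <= n)%N ->
  growth p r b (n - k) * growth p r' b' k / growth p r'' (b + b') n =
  expR (r * (n - k)%:R `^ p + r' * k%:R `^ p - r'' * n%:R `^ p) *
  ((n - k).+1%:R / n.+1%:R) `^ (- b) * (k.+1%:R / n.+1%:R) `^ (- b').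
Proof.
move=> kn; rewrite /growth !expRD expRN.
have q j a : j.+1%:R `^ a = expR (a * ln j.+1%:R) :> R.
  by rewrite /powR pnatr_eq0.
have qr j a : (j.+1%:R / n.+1%:R) `^ a = expR (a * ln j.+1%:R - a * ln n.+1%:R) :> R.
  rewrite /powR gt_eqF ?divr_gt0//; congr expR.
  by rewrite ln_div ?posrE// mulrBr.
rewrite !qr !q -!expRN; set X := n%:R `^ p.
by rewrite -!expRD -!expRN -!expRD; congr expR; ring.
Qed.

(** The square of the deviation [k - lam * n] measured in units of the Gaussian width [n^(1-p/2)],
    written through the ratio [k / n]. *)
Definition spread p (lam : R) n k : R := n%:R `^ p * (k%:R / n%:R - lam) ^+ 2.

(** Reflecting [k] to [n - k] lets bounds on the index of one factor serve for the other, with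
    [1 - lam] in place of [lam]. *)
Lemma spread_rev p lam n k : p != 0 -> (k <= n)%N ->
  spread p (1 - lam) n (n - k) = spread p lam n k.
Proof.
move=> p0 kn; case: n kn => [|n] kn; first by rewrite /spread powR0// !mul0r.
have n0 : n.+1%:R != 0 :> R by rewrite pnatr_eq0.
rewrite /spread natrB//; congr (_ * _); rewrite -[RHS]sqrrN; congr (_ ^+ 2).
by field; rewrite addrC natr1.
Qed.

(** Brings a term of the exponent into the variable [z / (x * N)], which equals 1 at the maximum. *)
Lemma powR_homogeneous p (x z N : R) : 0 < x -> 0 <= z -> 0 < N ->
  x `^ (1 - p) * z `^ p = N `^ p * (x * (z / (x * N)) `^ p).
Proof.
move=> x0 z0 N0; rewrite powRB ?(gt_eqF x0) ?implybT// powRr1 ?ltW//.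
rewrite powR_div ?(mulr_ge0, ltW x0, ltW N0)// powRM ?ltW//.
by field; rewrite !gt_eqF ?powR_gt0.
Qed.

(** The parabola bound is used for [t] and only the tangent bound for [u]: the linear terms cancel
    by [uE], and the quadratic loss in [t] alone already yields the [spread]. *)
Lemma exponent_le_spread p lam : 0 < p < 1 -> 0 < lam < 1 ->
  exists2 c, 0 < c & forall n k, (k <= n)%N ->
    (1 - lam) `^ (1 - p) * (n - k)%:R `^ p + lam `^ (1 - p) * k%:R `^ p
      <= n%:R `^ p - c * spread p lam n k.
Proof.
move=> p01 /andP[l0 l1]; have /andP[p0 p1] := p01.
(* The parabola is taken up to [T = lam^-1], the largest value of [t]; the division by [lam] comes
   from [lam * (t - 1)^2 = (k / n - lam)^2 / lam]. *)
exists (p * (1 - p) / 2 * lam^-1 `^ (p - 2) / lam).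
  by rewrite !(divr_gt0, mulr_gt0) ?powR_gt0 ?invr_gt0 ?subr_gt0.
move=> n k; case: n => [|n] kn.
  move: kn; rewrite leqn0 => /eqP ->.
  by rewrite /spread subnn powR0 ?gt_eqF// !(mulr0, mul0r) addr0 subr0.
set N : R := n.+1%:R; have N0 : 0 < N by rewrite ltr0n.
rewrite (powR_homogeneous _ _ _ N0) ?subr_gt0// (powR_homogeneous _ _ _ N0)//.
rewrite -mulrDr /spread.
set t := k%:R / (lam * N); set u := (n.+1 - k)%:R / ((1 - lam) * N).
have t0 : 0 <= t by rewrite divr_ge0// mulr_ge0// ltW.
have u0 : 0 <= u by rewrite divr_ge0// mulr_ge0 ?subr_ge0// ltW.
have tT : t <= lam^-1.
  rewrite /t invfM mulrA -[leRHS]mul1r mulrAC ler_wpM2r ?invr_ge0 ?(ltW l0)//.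
  by rewrite ler_pdivrMr// mul1r ler_nat.
have lT : 1 <= lam^-1 by rewrite invf_ge1// ltW.
have ht := @powR_le_parabola _ p lam^-1 t p01 lT.
rewrite t0 tT in ht; have {ht} ht := ht isT.
have hu := powR_le_tangent p01 u0.
have tE : k%:R / N - lam = lam * (t - 1).
  by rewrite /t; field; rewrite !gt_eqF.
have uE : (1 - lam) * (u - 1) = - (lam * (t - 1)).
  rewrite -tE /u natrB// -/N; field.
  by rewrite !gt_eqF// subr_gt0.
rewrite tE; set K := (p * (1 - p) / 2 * lam^-1 `^ (p - 2)) in ht *.
have -> : N `^ p - K / lam * (N `^ p * (lam * (t - 1)) ^+ 2) =
    N `^ p * (1 - K * lam * (t - 1) ^+ 2).
  by field; rewrite gt_eqF.
rewrite ler_wpM2l ?powR_ge0//.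
have h1 := ler_wpM2l (ltW l0) ht.
have l1' : 0 <= 1 - lam by rewrite subr_ge0 ltW.
have h2 := ler_wpM2l l1' hu.
have h3 : p * ((1 - lam) * (u - 1)) = - (p * (lam * (t - 1))) by rewrite uE mulrN.
apply: (le_trans (lerD h2 h1)).
lra.
Qed.

(** The two sides differ by [(n+1)^(p-2)] against [n^(p-2)], a decreasing power; at [n = 0] both
    sides vanish. *)
Lemma sqr_deviation_le_spread p lam n k : 0 < p < 1 -> (k <= n)%N ->
  ((k%:R - lam * n%:R) / n.+1%:R `^ (1 - p / 2)) ^+ 2 <= spread p lam n k.
Proof.
move=> /andP[p0 p1]; case: n => [|n] kn.
  move: kn; rewrite leqn0 => /eqP ->.
  by rewrite /spread mulr0 subr0 mul0r expr0n powR0 ?gt_eqF// mul0r.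
rewrite /spread exprMn -powRN -[X in _ * X]powR_mulrn ?powR_ge0// -powRrM.
have n0 : 0 < n.+1%:R :> R by rewrite ltr0n.
have -> : k%:R / n.+1%:R - lam = (k%:R - lam * n.+1%:R) / n.+1%:R :> R.
  by field; rewrite addrC natr1 gt_eqF.
rewrite exprMn mulrCA ler_wpM2l ?sqr_ge0//.
have -> : - (1 - p / 2) * 2 = p - 2 by field.
have -> : n.+1%:R `^ p * n.+1%:R^-1 ^+ 2 = n.+1%:R `^ (p - 2) :> R.
  by rewrite powRB ?(gt_eqF n0) ?implybT// powR_mulrn ?ltW// exprVn.
rewrite (_ : p - 2 = - (2 - p)); last by ring.
rewrite !powRN lef_pV2 ?posrE ?powR_gt0//.
by apply: ge0_ler_powR; rewrite ?nnegrE ?ler_nat//; lra.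
Qed.

(** Only [b > 0] with small [k] is delicate. If [k >= lam * n / 2], the ratio is at least [lam / 2].
    Otherwise [spread] is at least [lam^2 / 4 * n^p], and its exponential absorbs the crude bound
    [(n+1)^b]. *)
Lemma powR_ratio_le_spread p lam b c : 0 < p -> 0 < lam < 1 -> 0 < c ->
  exists2 C, 0 < C & forall n k, (k <= n)%N ->
    (k.+1%:R / n.+1%:R) `^ (- b) <= C * expR (c * spread p lam n k).
Proof.
move=> p0 /andP[l0 l1] c0.
have s0 n k : 0 <= spread p lam n k by rewrite mulr_ge0 ?powR_ge0 ?sqr_ge0.
have e1 n k : 1 <= expR (c * spread p lam n k).
  by rewrite -expR0 ler_expR mulr_ge0// ltW.
have x1 n k : (k <= n)%N -> k.+1%:R / n.+1%:R <= 1 :> R.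
  by move=> kn; rewrite ler_pdivrMr// mul1r ler_nat.
have [b0|b0] := leP b 0.
  exists 1 => // n k kn; rewrite mul1r (le_trans _ (e1 n k))//.
  apply: (@le_trans _ _ (1 `^ (- b))); last by rewrite powR1.
  apply: ge0_ler_powR; rewrite ?nnegrE ?oppr_ge0//.
  exact: x1.
have [|C C0 hC] := @natr_powR_le_expR R p b (c * (lam ^+ 2 / 4)) p0.
  by rewrite mulr_gt0// divr_gt0// exprn_gt0.
have anti (x z : R) : 0 < x -> x <= z -> z `^ (- b) <= x `^ (- b).
  move=> x0 xz; have z0 := lt_le_trans x0 xz.
  rewrite !powRN lef_pV2 ?posrE ?powR_gt0//.
  by apply: ge0_ler_powR; rewrite ?nnegrE ?(ltW b0) ?(ltW x0) ?(ltW z0).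
have l20 : 0 < lam / 2 by rewrite divr_gt0.
exists ((lam / 2) `^ (- b) + C) => [|n k kn]; first by rewrite addr_gt0 ?powR_gt0.
have [kl|kl] := leP (lam / 2 * n%:R) k%:R.
  apply: (@le_trans _ _ ((lam / 2) `^ (- b))).
    apply: anti => //; rewrite ler_pdivlMr// -(natr1 n) -(natr1 k); lra.
  rewrite -[leLHS]mulr1 ler_pM ?powR_ge0// lerDl ltW//.
apply: (@le_trans _ _ (n.+1%:R `^ b)).
  have -> : n.+1%:R `^ b = n.+1%:R^-1 `^ (- b) :> R.
    by rewrite -powR_inv1// -powRrM mulN1r opprK.
  apply: anti; first by rewrite invr_gt0.
  by rewrite -[leLHS]mul1r ler_wpM2r ?invr_ge0// ler1n.
apply: (le_trans (hC n)); apply: ler_pM; rewrite ?expR_ge0 ?(ltW C0)//.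
  by rewrite lerDr powR_ge0.
rewrite ler_expR -mulrA ler_wpM2l ?(ltW c0)// mulrC ler_wpM2l ?powR_ge0//.
have n0 : 0 < n%:R :> R.
  by case: n kn kl => [|n] kn; rewrite ?ltr0n// mulr0 ltNge ler0n.
have : k%:R / n%:R < lam / 2 by rewrite ltr_pdivrMr.
set x := k%:R / n%:R => xl; nra.
Qed.

End laplace.

(** * Limits near the maximum *)

Section laplace_limit.
Variable R : realType.
Implicit Types (a b c lam p r y : R) (n k : nat).

Lemma cvgn_invn : (fun n => n%:R^-1 : R) @ \oo --> (0 : R).
Proof.
apply/cvgrVy; first by near=> n; rewrite invr_gt0 ltr0n; near: n; exact: nbhs_infty_gt.
apply: cvg_trans (@cvgr_idn R); apply: near_eq_cvg; apply: nearW => n.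
by rewrite /= invrK.
Unshelve. all: by end_near. Qed.

Lemma cvgn_natr_succ_powR a : 0 < a -> (fun n => n.+1%:R `^ a : R) @ \oo --> +oo.
Proof.
by move=> a0; have := cvg_natr_powR a0; rewrite -cvg_shiftS.
Qed.

(** The Gaussian window is negligible compared with [n], by a factor of order [n^(-p/2)]. *)
Lemma cvgn_scale_div p : 0 < p ->
  (fun n => n.+1%:R `^ (1 - p / 2) / n%:R : R) @ \oo --> (0 : R).
Proof.
move=> p0; rewrite -[X in _ --> X](mulr0 1).
apply: (@cvg_trans _
    ((fun n => n.+1%:R / n%:R * (n.+1%:R `^ (p / 2))^-1 : R) @ \oo)).
  apply: near_eq_cvg; apply: nearW => n /=.
  by rewrite powRB ?pnatr_eq0 ?implybT// powRr1// mulrAC.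
apply: cvgM; first exact: cvgn_succ_ratio.
apply/cvgrVy; first by apply: nearW => n; rewrite invr_gt0 powR_gt0.
apply: cvg_trans (@cvgn_natr_succ_powR (p / 2) _); last by rewrite divr_gt0.
by apply: near_eq_cvg; apply: nearW => n; rewrite /= invrK.
Qed.

Lemma cvgn_nat_of_ratio (j : nat -> nat) (x : R) : 0 < x ->
  (fun n => (j n)%:R / n%:R) @ \oo --> x -> j @ \oo --> \oo.
Proof.
move=> x0 jx; apply/cvgnyPge => A.
have x20 : 0 < x / 2 by rewrite divr_gt0.
have xx : x / 2 < x by lra.
have nA := (cvgryPge (fun n : nat => n%:R : R)).1 cvgr_idn (A%:R / (x / 2)).
near=> n.
have n0 : (0 < n)%N by near: n; exact: nbhs_infty_gt.
have h : x / 2 < (j n)%:R / n%:R by near: n; exact: (cvgr_gt x).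
have An : A%:R / (x / 2) <= n%:R by near: n; exact: nA.
rewrite -(ler_nat R); move: h An; rewrite ltr_pdivlMr ?ltr0n// ler_pdivrMr//.
lra.
Unshelve. all: by end_near. Qed.

Lemma cvgn_succ_ratio_of_ratio (j : nat -> nat) (x : R) :
  (fun n => (j n)%:R / n%:R) @ \oo --> x ->
  (fun n => (j n).+1%:R / n.+1%:R) @ \oo --> x.
Proof.
move=> jx; have -> : x = (x + 0) / 1 by rewrite addr0 divr1.
apply: (@cvg_trans _
    ((fun n => ((j n)%:R / n%:R + n%:R^-1) / (n.+1%:R / n%:R)) @ \oo)).
  apply: near_eq_cvg; near=> n.
  have n0 : n%:R != 0 :> R.
    by rewrite pnatr_eq0 -lt0n; near: n; exact: nbhs_infty_gt.
  have n1 : n.+1%:R != 0 :> R by rewrite pnatr_eq0.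
  by rewrite -(natr1 (j n)); field; rewrite n0 addrC natr1 n1.
apply: cvgM; first by apply: cvgD => //; exact: cvgn_invn.
by apply: cvgV; [exact: oner_neq0|exact: cvgn_succ_ratio].
Unshelve. all: by end_near. Qed.

(** The intermediate point of the Taylor formula is squeezed between 1 and [t n], so its power
    [p - 2] tends to 1. *)
Lemma powR_second_order p (t : nat -> R) : t @ \oo --> (1 : R) ->
  exists2 phi : nat -> R, phi @ \oo --> p * (1 - p) / 2 &
    forall n, 0 < t n ->
      t n `^ p = 1 + p * (t n - 1) - phi n * (t n - 1) ^+ 2.
Proof.
move=> t1.
(* The value [xi = 1] serves where the Taylor formula does not apply, namely for [t n <= 0] and
   [t n = 1]. *)
have /choice[xi xiP] n : exists xi : R, Num.min 1 (t n) <= xi <= Num.max 1 (t n) /\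
    (0 < t n -> t n `^ p =
      1 + p * (t n - 1) - p * (1 - p) / 2 * xi `^ (p - 2) * (t n - 1) ^+ 2).
  have [t0|t0] := leP (t n) 0.
    by exists 1; rewrite ge_min le_max lexx; split.
  have [->|tn1] := eqVneq (t n) 1.
    exists 1; rewrite ge_min le_max lexx; split => // _.
    by rewrite powR1 subrr expr0n !mulr0 addr0 subr0.
  have [xi /andP[x1 x2] ->] := powR_taylor2 p t0 tn1.
  by exists xi; rewrite !ltW.
exists (fun n => p * (1 - p) / 2 * xi n `^ (p - 2)); last by move=> n /(xiP n).2.
have xi1 : xi @ \oo --> (1 : R).
  have d0 : (fun n => `|1 - t n|) @ \oo --> (0 : R).
    rewrite -[X in _ --> X](normr0 R) -[X in `|X|](subrr 1).
    by apply: cvg_norm; apply: cvgB => //; exact: cvg_cst.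
  have low : (fun n => 1 - `|1 - t n|) @ \oo --> (1 : R).
    by rewrite -[X in _ --> X]subr0; apply: cvgB => //; exact: cvg_cst.
  have upp : (fun n => 1 + `|1 - t n|) @ \oo --> (1 : R).
    by rewrite -[X in _ --> X]addr0; apply: cvgD => //; exact: cvg_cst.
  apply: squeeze_cvgr low upp.
  apply: nearW => n; have [/andP[]] := xiP n.
  rewrite ge_min le_max => h1 h2 _.
  have := ler_norm (1 - t n); have := ler_norm (t n - 1); rewrite (distrC (t n)).
  move: h1 h2; have := normr_ge0 (1 - t n).
  by move=> ? /orP[]? /orP[]? ? ?; lra.
have KE : p * (1 - p) / 2 = p * (1 - p) / 2 * 1 `^ (p - 2) by rewrite powR1 mulr1.
rewrite [X in _ --> X]KE.
by apply: cvgM; [exact: cvg_cst|exact: cvg_powR_pos].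
Qed.

(** * Index sequences at a convergent rescaled distance from the maximum *)

Section along_sequence.
Variables (p lam y : R) (j : nat -> nat).
Hypotheses (p0 : 0 < p) (l0 : 0 < lam) (l1 : lam < 1).
Hypothesis jn : forall n, (j n <= n)%N.
Let dev n : R := ((j n)%:R - lam * n%:R) / n.+1%:R `^ (1 - p / 2).
Hypothesis devy : dev @ \oo --> y.

Lemma cvgn_ratio : (fun n => (j n)%:R / n%:R : R) @ \oo --> lam.
Proof.
have -> : lam = lam + y * 0 by rewrite mulr0 addr0.
apply: (@cvg_trans _
    ((fun n => lam + dev n * (n.+1%:R `^ (1 - p / 2) / n%:R)) @ \oo)).
  apply: near_eq_cvg; near=> n.
  have n0 : n%:R != 0 :> R.
    by rewrite pnatr_eq0 -lt0n; near: n; exact: nbhs_infty_gt.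
  by rewrite /dev; field; rewrite n0 gt_eqF ?powR_gt0.
apply: cvgD; first exact: cvg_cst.
by apply: cvgM => //; exact: cvgn_scale_div.
Unshelve. all: by end_near. Qed.

Lemma cvgn_ratio_rev : (fun n => (n - j n)%:R / n%:R : R) @ \oo --> 1 - lam.
Proof.
apply: (@cvg_trans _ ((fun n => 1 - (j n)%:R / n%:R) @ \oo)).
  apply: near_eq_cvg; near=> n.
  have n0 : n%:R != 0 :> R.
    by rewrite pnatr_eq0 -lt0n; near: n; exact: nbhs_infty_gt.
  by rewrite natrB//; field.
by apply: cvgB; [exact: cvg_cst|exact: cvgn_ratio].
Unshelve. all: by end_near. Qed.

(** The linear terms of the expansions of [t] and [u] cancel, and the quadratic ones add up through
    [1 / lam + 1 / (1 - lam) = 1 / (lam * (1 - lam))]. *)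
Lemma cvgn_exponent :
  (fun n => (1 - lam) `^ (1 - p) * (n - j n)%:R `^ p
     + lam `^ (1 - p) * (j n)%:R `^ p - n%:R `^ p) @ \oo -->
  - (p * (1 - p) / (2 * lam * (1 - lam)) * y ^+ 2).
Proof.
have l1' : 0 < 1 - lam by rewrite subr_gt0.
pose t n : R := (j n)%:R / (lam * n%:R).
pose u n : R := (n - j n)%:R / ((1 - lam) * n%:R).
have t1 : t @ \oo --> (1 : R).
  rewrite -(divff (lt0r_neq0 l0)).
  apply: (@cvg_trans _ ((fun n => (j n)%:R / n%:R / lam) @ \oo)).
    apply: near_eq_cvg; apply: nearW => n.
    by rewrite /t invfM mulrA mulrAC.
  by apply: cvgM; [exact: cvgn_ratio|exact: cvg_cst].
have u1 : u @ \oo --> (1 : R).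
  rewrite -(divff (lt0r_neq0 l1')).
  apply: (@cvg_trans _ ((fun n => (n - j n)%:R / n%:R / (1 - lam)) @ \oo)).
    apply: near_eq_cvg; apply: nearW => n.
    by rewrite /u invfM mulrA mulrAC.
  by apply: cvgM; [exact: cvgn_ratio_rev|exact: cvg_cst].
have [phi phil phiE] := powR_second_order p t1.
have [psi psil psiE] := powR_second_order p u1.
(* The factor [1^(2-p)] is the limit of [((n+1)/n)^(2-p)], which appears because [dev] is scaled by
   a power of [n+1] whereas the exponent involves [n]. *)
have -> : - (p * (1 - p) / (2 * lam * (1 - lam)) * y ^+ 2) =
    - (y ^+ 2 * 1 `^ (2 - p) *
      (p * (1 - p) / 2 / (1 - lam) + p * (1 - p) / 2 / lam)).
  by rewrite powR1; field; rewrite !gt_eqF.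
apply: (@cvg_trans _ ((fun n => - (dev n ^+ 2 * (n.+1%:R / n%:R) `^ (2 - p) *
      (psi n / (1 - lam) + phi n / lam))) @ \oo)); last first.
  apply: cvgN; apply: cvgM.
    apply: cvgM; first exact: cvgM.
    by apply: cvg_powR_pos => //; exact: cvgn_succ_ratio.
  by apply: cvgD; apply: cvgM => //; exact: cvg_cst.
apply: near_eq_cvg; near=> n.
have n0 : 0 < n%:R :> R by rewrite ltr0n; near: n; exact: nbhs_infty_gt.
have t0 : 0 < t n by near: n; exact: (cvgr_gt 1).
have u0 : 0 < u n by near: n; exact: (cvgr_gt 1).
rewrite (powR_homogeneous _ _ _ n0)// (powR_homogeneous _ _ _ n0)//.
rewrite -/(t n) -/(u n) (phiE _ t0) (psiE _ u0).
pose s : R := n.+1%:R `^ (1 - p / 2).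
have s0 : 0 < s by rewrite powR_gt0.
have tE : t n - 1 = dev n * s / n%:R / lam.
  by rewrite /t /dev -/s; field; rewrite !gt_eqF.
have uE : u n - 1 = - (dev n * s / n%:R / (1 - lam)).
  by rewrite /u /dev -/s natrB//; field; rewrite !gt_eqF.
have rE : (n.+1%:R / n%:R) `^ (2 - p) = n%:R `^ p * s ^+ 2 / n%:R ^+ 2.
  rewrite powR_div// ?ltW// /s -powR_mulrn ?powR_ge0// -powRrM.
  have -> : (1 - p / 2) * 2 = 2 - p by field.
  rewrite [X in _ / X]powRB ?(gt_eqF n0) ?implybT// (powR_mulrn 2) ?ltW//.
  by field; rewrite !gt_eqF ?powR_gt0.
rewrite rE tE uE; field.
by rewrite !gt_eqF.
Unshelve. all: by end_near. Qed.

End along_sequence.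

End laplace_limit.

(** * Asymptotics of the convolution *)

Section convolution.
Variable R : realType.

(** The Gaussian sum contributes its width [(n+1)^(1-p/2)], which shifts [b0 + b1] by [p / 2 - 1].
    The powers of [1 - lam] and [lam] are the limits of the denominators' ratios at the maximum. *)
Lemma cvgn_growth_convolution (p rho lam b0 b1 v0 v1 : R) (x y : nat -> R) :
  0 < p < 1 -> 0 < rho -> 0 < lam < 1 ->
  (fun n => x n / growth p (rho * (1 - lam) `^ (1 - p)) b0 n) @ \oo --> v0 ->
  (fun n => y n / growth p (rho * lam `^ (1 - p)) b1 n) @ \oo --> v1 ->
  (fun n => seq_convolution x y n / growth p rho (b0 + b1 + p / 2 - 1) n)
    @ \oo --> v0 * v1 * (1 - lam) `^ (- b0) * lam `^ (- b1) *
      Num.sqrt (pi / (rho * (p * (1 - p) / (2 * lam * (1 - lam))))).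
Proof.
move=> p01 rho0 l01 xv yv; have /andP[p0 p1] := p01; have /andP[l0 l1] := l01.
have l1' : 0 < 1 - lam by rewrite subr_gt0.
have l01' : 0 < 1 - lam < 1 by rewrite l1' gtrBl.
set r0 := rho * _ in xv; set r1 := rho * _ in yv.
pose X n := x n / growth p r0 b0 n; pose Y n := y n / growth p r1 b1 n.
pose w n k := x (n - k)%N * y k / growth p rho (b0 + b1) n.
pose e n k := r0 * (n - k)%:R `^ p + r1 * k%:R `^ p - rho * n%:R `^ p.
(* Each normalised term splits into the convergent, hence bounded, factors [X] and [Y] and an
   explicit one. *)
have wE n k : (k <= n)%N -> w n k = X (n - k)%N * Y k * (expR (e n k) *
    ((n - k).+1%:R / n.+1%:R) `^ (- b0) * (k.+1%:R / n.+1%:R) `^ (- b1)).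
  move=> kn; rewrite -growth_ratio// /w /X /Y.
  by field; rewrite !gt_eqF ?growth_gt0.
have [MX hX] : exists M, forall n, `|X n| <= M by exact: cvgn_normr_bounded xv.
have [MY hY] : exists M, forall n, `|Y n| <= M by exact: cvgn_normr_bounded yv.
have [c c0 ec] := exponent_le_spread p01 l01.
have rc0 : 0 < rho * c by rewrite mulr_gt0.
(* The terms decay like [expR (- (rho * c * spread))]; each of the two power
   ratios may consume a quarter of the constant, and half of it is left. *)
have rc4 : 0 < rho * c / 4 by rewrite divr_gt0.
have [C0 C00 hC0] :=
  @powR_ratio_le_spread R p (1 - lam) b0 (rho * c / 4) p0 l01' rc4.
have [C1 C10 hC1] := @powR_ratio_le_spread R p lam b1 (rho * c / 4) p0 l01 rc4.
pose m n : R := lam * n%:R; pose s n : R := n.+1%:R `^ (1 - p / 2).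
have p20 : 0 < 1 - p / 2 by lra.
have s1 n : 1 <= s n.
  by rewrite -[leLHS](powRr0 n.+1%:R) ler_powR ?ler1n// ltW.
have soo : s @ \oo --> +oo by exact: cvgn_natr_succ_powR.
have wdom n k : (k <= n)%N -> `|w n k| <=
    MX * MY * (C0 * C1) * expR (- (rho * c / 2 * ((k%:R - m n) / s n) ^+ 2)).
  move=> kn.
  have P0 : 0 <= expR (e n k) * ((n - k).+1%:R / n.+1%:R) `^ (- b0) *
      (k.+1%:R / n.+1%:R) `^ (- b1).
    by rewrite !mulr_ge0 ?expR_ge0 ?powR_ge0.
  rewrite wE// [leLHS]normrM (ger0_norm P0) [`|X _ * Y _|]normrM -mulrA.
  have E1 : expR (e n k) <= expR (- (rho * c * spread p lam n k)).
    have := ler_wpM2l (ltW rho0) (ec n k kn).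
    rewrite ler_expR /e /r0 /r1; lra.
  have E2 := hC0 n (n - k)%N (leq_subr _ _).
  rewrite spread_rev ?gt_eqF// in E2.
  have E3 := hC1 n k kn.
  have D := sqr_deviation_le_spread lam p01 kn.
  apply: (@le_trans _ _ (MX * (MY * (expR (- (rho * c * spread p lam n k)) *
      (C0 * expR (rho * c / 4 * spread p lam n k)) *
      (C1 * expR (rho * c / 4 * spread p lam n k)))))).
    apply: (ler_pM (normr_ge0 _) _ (hX _)); first by rewrite mulr_ge0.
    apply: (ler_pM (normr_ge0 _) P0 (hY _)).
    apply: (ler_pM _ (powR_ge0 _ _) _ E3); first by rewrite mulr_ge0 ?expR_ge0 ?powR_ge0.
    exact: (ler_pM (expR_ge0 _) (powR_ge0 _ _) E1 E2).
  have -> : MX * (MY * (expR (- (rho * c * spread p lam n k)) *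
      (C0 * expR (rho * c / 4 * spread p lam n k)) *
      (C1 * expR (rho * c / 4 * spread p lam n k)))) =
    MX * MY * (C0 * C1) * (expR (- (rho * c * spread p lam n k)) *
      expR (rho * c / 4 * spread p lam n k) *
      expR (rho * c / 4 * spread p lam n k)) by ring.
  rewrite -!expRD ler_wpM2l//.
    rewrite !mulr_ge0 ?(ltW C00) ?(ltW C10)//.
      exact: le_trans (normr_ge0 _) (hX 0%N).
    exact: le_trans (normr_ge0 _) (hY 0%N).
  have rc2 : 0 <= rho * c / 2 by lra.
  rewrite ler_expR; have := ler_wpM2l rc2 D; rewrite -/(m n) -/(s n); lra.
pose A := v0 * v1 * (1 - lam) `^ (- b0) * lam `^ (- b1).
pose kap := rho * (p * (1 - p) / (2 * lam * (1 - lam))).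
have kap0 : 0 < kap by rewrite mulr_gt0// divr_gt0// !mulr_gt0// subr_gt0.
have wlim (z : R) (j : nat -> nat) : (forall n, (j n <= n)%N) ->
    (fun n => ((j n)%:R - m n) / s n) @ \oo --> z ->
    (fun n => w n (j n)) @ \oo --> A * expR (- (kap * z ^+ 2)).
  move=> jn jz.
  have jl := cvgn_ratio p0 jz.
  have jl' := cvgn_ratio_rev p0 jn jz.
  apply: (@cvg_trans _ ((fun n => X (n - j n)%N * Y (j n) * (expR (e n (j n)) *
    ((n - j n).+1%:R / n.+1%:R) `^ (- b0) * ((j n).+1%:R / n.+1%:R) `^ (- b1))) @ \oo)).
    by apply: near_eq_cvg; apply: nearW => n; rewrite /= wE.
  have -> : A * expR (- (kap * z ^+ 2)) = v0 * v1 *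
      (expR (- (kap * z ^+ 2)) * (1 - lam) `^ (- b0) * lam `^ (- b1)).
    by rewrite /A; ring.
  apply: cvgM.
    apply: cvgM.
      apply: (@cvg_comp _ _ _ (fun n => n - j n)%N X _ \oo _ _ xv).
      exact: cvgn_nat_of_ratio jl'.
    apply: (@cvg_comp _ _ _ j Y _ \oo _ _ yv).
    exact: cvgn_nat_of_ratio jl.
  apply: cvgM; last first.
    by apply: cvg_powR_pos => //; exact: cvgn_succ_ratio_of_ratio.
  apply: cvgM; last first.
    by apply: cvg_powR_pos => //; exact: (@cvgn_succ_ratio_of_ratio _ (fun n => n - j n)%N).
  apply: (@continuous_cvg _ _ _ _ _ (fun n => e n (j n)) (@expR R)).
    exact: continuous_expR.
  have -> : - (kap * z ^+ 2) =
      rho * - (p * (1 - p) / (2 * lam * (1 - lam)) * z ^+ 2).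
    by rewrite /kap -mulrA mulrN.
  apply: (@cvg_trans _ ((fun n => rho * ((1 - lam) `^ (1 - p) * (n - j n)%:R `^ p
      + lam `^ (1 - p) * (j n)%:R `^ p - n%:R `^ p)) @ \oo)).
    apply: near_eq_cvg; apply: nearW => n.
    by rewrite /e /r0 /r1; ring.
  by apply: cvgM; [exact: cvg_cst|exact: cvgn_exponent].
(* Divided by [n], the position tends to [lam], which lies strictly between 0 and 1. *)
have zlim (z : R) : \forall n \near \oo, 0 <= m n + s n * z < n.+1%:R.
  have h : (fun n => lam + s n / n%:R * z) @ \oo --> lam + 0 * z.
    apply: cvgD; first exact: cvg_cst.
    by apply: cvgM; [exact: cvgn_scale_div|exact: cvg_cst].
  rewrite mul0r addr0 in h.
  near=> n.
  have n0 : 0 < n%:R :> R by rewrite ltr0n; near: n; exact: nbhs_infty_gt.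
  have h0 : 0 < lam + s n / n%:R * z by near: n; exact: (cvgr_gt lam).
  have h1 : lam + s n / n%:R * z < 1 by near: n; exact: (cvgr_lt lam).
  have -> : m n + s n * z = (lam + s n / n%:R * z) * n%:R.
    by rewrite /m; field; rewrite gt_eqF.
  rewrite mulr_ge0 ?(ltW h0) ?(ltW n0)//=.
  rewrite (@lt_le_trans _ _ (1 * n%:R)) ?ltr_pM2r// mul1r ler_nat.
  exact: leqnSn.
have := riemann_sum_gauss _ kap0 s1 soo wdom wlim zlim.
rewrite divr_gt0// => /(_ isT).
apply: cvg_trans; apply: near_eq_cvg; apply: nearW => n /=.
have -> : growth p rho (b0 + b1 + p / 2 - 1) n = growth p rho (b0 + b1) n * s n.
  rewrite /growth /s -mulrA; congr (_ * _).
  by rewrite -!powRN -powRD ?pnatr_eq0 ?implybT//; congr (_ `^ _); ring.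
by rewrite /w -mulr_suml -mulrA -invfM.
Unshelve. all: by end_near. Qed.

End convolution.

(** * Identification of the constants *)

Theorem theorem3 (R : realType) (p r1 r2 v1 v2 b1 b2 : R)
    (hr1 : 0 < r1) (hr12 : r1 < r2) (hp0 : 0 < p) (hp1 : p < 1)
    (hv1 : v1 != 0) (hv2 : v2 != 0)
    (gamma alpha : nat -> R) (r0 v0 b0 : R)
    (hv0 : v0 != 0) (hr0 : 0 < r0)
    (hgamma : seq_equiv gamma (exp_pow p v0 r0 b0))
    (halpha : seq_equiv alpha (exp_pow p v1 r1 b1))
    (hc : seq_equiv (seq_convolution gamma alpha) (exp_pow p v2 r2 b2)) :
  [/\ r0 = (r2 `^ (1 / (1 - p)) - r1 `^ (1 / (1 - p))) `^ (1 - p),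
      b0 = b2 - b1 - p / 2 + 1 &
      v0 = (Num.sqrt ((1 - p) * p) * v2
              * r2 `^ ((1 - 2 * b2) / (2 * (1 - p)))
              * (r2 `^ (1 / (1 - p)) - r1 `^ (1 / (1 - p)))
                  `^ (b2 - b1 - p / 2 + 1 / 2))
           / (Num.sqrt (2 * pi) * v1 * r1 `^ ((1 - 2 * b1) / (2 * (1 - p))))].
Proof.
have q0 : 0 < 1 - p by rewrite subr_gt0.
(* The abbreviations are introduced through existentials so that they stay opaque and are unfolded
   only by rewriting. *)
have [s0 s0D] : exists a : R, a = r0 `^ (1 / (1 - p)) by exists (r0 `^ (1 / (1 - p))).
have [s1 s1D] : exists a : R, a = r1 `^ (1 / (1 - p)) by exists (r1 `^ (1 / (1 - p))).
have s00 : 0 < s0 by rewrite s0D powR_gt0.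
have s10 : 0 < s1 by rewrite s1D powR_gt0.
have powK (a : R) : 0 <= a -> (a `^ (1 / (1 - p))) `^ (1 - p) = a.
  by move=> a0; rewrite -powRrM divfK ?gt_eqF// powRr1.
have [S SD] : exists a : R, a = s0 + s1 by exists (s0 + s1).
have [lam lamD] : exists a : R, a = s1 / S by exists (s1 / S).
have [rho rhoD] : exists a : R, a = S `^ (1 - p) by exists (S `^ (1 - p)).
have S0 : 0 < S by rewrite SD addr_gt0.
have lamE : 1 - lam = s0 / S by rewrite lamD SD; field; rewrite -SD gt_eqF.
have l01 : 0 < lam < 1.
  by rewrite lamD divr_gt0//= ltr_pdivrMr// mul1r SD ltrDr.
have rho0 : 0 < rho by rewrite rhoD powR_gt0.
have rhoM (a : R) : 0 <= a -> rho * (a / S) `^ (1 - p) = a `^ (1 - p).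
  move=> a0; rewrite rhoD powR_div ?(ltW S0)// mulrC divfK//.
  by rewrite gt_eqF// powR_gt0.
have r0E : r0 = rho * (1 - lam) `^ (1 - p).
  by rewrite lamE rhoM ?(ltW s00)// s0D powK// ltW.
have r1E : r1 = rho * lam `^ (1 - p) by rewrite lamD rhoM ?(ltW s10)// s1D powK// ltW.
have hx := seq_equiv_growth hv0 hgamma; rewrite r0E in hx.
have hy := seq_equiv_growth hv1 halpha; rewrite r1E in hy.
have hz := seq_equiv_growth hv2 hc.
have hW := cvgn_growth_convolution (introT andP (conj hp0 hp1)) rho0 l01 hx hy.
set W := (X in _ --> X) in hW.
have /andP[l0 l1] := l01; have l1' : 0 < 1 - lam by rewrite subr_gt0.
(* A nonzero limit is what the uniqueness of the exponents requires. *)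
have W0 : W != 0.
  have k0 : 0 < rho * (p * (1 - p) / (2 * lam * (1 - lam))).
    by rewrite mulr_gt0// divr_gt0// !mulr_gt0.
  have sq0 : 0 < Num.sqrt (pi / (rho * (p * (1 - p) / (2 * lam * (1 - lam))))).
    by rewrite sqrtr_gt0 divr_gt0 ?pi_gt0.
  by rewrite /W !mulf_neq0 ?(gt_eqF sq0)// gt_eqF// powR_gt0.
(* The quotient of the two asymptotics of the convolution; the convolution cancels because it is
   eventually nonzero, as [v2 != 0]. *)
have ratio : (fun n => growth p r2 b2 n / growth p rho (b0 + b1 + p / 2 - 1) n)
    @ \oo --> W / v2.
  apply: (@cvg_trans _ ((fun n =>
      seq_convolution gamma alpha n / growth p rho (b0 + b1 + p / 2 - 1) n /
      (seq_convolution gamma alpha n / growth p r2 b2 n)) @ \oo)); last first.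
    by apply: cvgM => //; exact: cvgV.
  apply: near_eq_cvg; near=> n.
  have : seq_convolution gamma alpha n / growth p r2 b2 n != 0.
    by near: n; exact: cvgr_neq0 hz hv2.
  rewrite mulf_eq0 negb_or => /andP[c0 _].
  by field; rewrite c0 !gt_eqF ?growth_gt0.
have Wv0 : W / v2 != 0 by exact: mulf_neq0 W0 (invr_neq0 hv2).
have [r2E b2E] := growth_exponents_unique hp0 Wv0 ratio.
(* Once the exponents agree, [hW] and [hz] give limits of one and the same sequence. *)
have WE : W = v2.
  by move: hW hz; rewrite -b2E -r2E => /cvg_lim <-// /cvg_lim <-.
have SE : S = r2 `^ (1 / (1 - p)).
  by rewrite r2E rhoD -powRrM mulrC divfK ?gt_eqF// powRr1 ?ltW.
have s0E : r2 `^ (1 / (1 - p)) - r1 `^ (1 / (1 - p)) = s0.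
  by rewrite -SE SD -s1D addrK.
split; first by rewrite s0E s0D powK// ltW.
  by rewrite b2E; ring.
have powE (a b : R) : 0 < a -> a `^ b = expR (b * ln a)
  by move=> a0; rewrite /powR gt_eqF.
have r2pow : r2 `^ ((1 - 2 * b2) / (2 * (1 - p))) = S `^ (1 / 2 - b2).
  by rewrite SE -powRrM; congr (_ `^ _); field; rewrite gt_eqF.
have r1pow : r1 `^ ((1 - 2 * b1) / (2 * (1 - p))) = s1 `^ (1 / 2 - b1).
  by rewrite s1D -powRrM; congr (_ `^ _); field; rewrite gt_eqF.
have Qp0 : 0 < Num.sqrt ((1 - p) * p) by rewrite sqrtr_gt0 mulr_gt0.
have Qpi0 : 0 < Num.sqrt (2 * pi) :> R by rewrite sqrtr_gt0 mulr_gt0 ?pi_gt0.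
have sqrtE : Num.sqrt (pi / (rho * (p * (1 - p) / (2 * lam * (1 - lam))))) =
    Num.sqrt (2 * pi) / Num.sqrt ((1 - p) * p) *
      (lam * (1 - lam) / rho) `^ 2^-1.
  rewrite powR12_sqrt; last by rewrite !(mulr_ge0, invr_ge0)// ltW.
  rewrite -sqrtrV ?mulr_ge0 ?ltW// -!sqrtrM ?mulr_ge0 ?invr_ge0 ?mulr_ge0 ?pi_ge0 ?ltW//.
  by congr Num.sqrt; field; rewrite !gt_eqF.
rewrite s0E r2pow r1pow -WE /W sqrtE lamE lamD.
(* All powers become exponentials of multiples of [ln S], [ln s0] and [ln s1]. After [combine] has
   cancelled the square roots and [v1], a linear identity between these logarithms remains. *)
rewrite !powE ?(divr_gt0, mulr_gt0, powR_gt0)//.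
rewrite !(ln_div, lnM) ?posrE ?(divr_gt0, mulr_gt0)//.
have -> : ln rho = (1 - p) * ln S by rewrite rhoD ln_powR.
rewrite b2E.
have combine (A B C D E F : R) : A + B + C + D + E = F ->
    v0 = Num.sqrt ((1 - p) * p) * (v0 * v1 * expR A * expR B *
      (Num.sqrt (2 * pi) / Num.sqrt ((1 - p) * p) * expR C)) * expR D * expR E /
      (Num.sqrt (2 * pi) * v1 * expR F).
  move=> <-; rewrite !expRD; field.
  by rewrite !(gt_eqF (expR_gt0 _)) (gt_eqF Qp0) (gt_eqF Qpi0) hv1.
by apply: combine; field.
Unshelve. all: by end_near. Qed.
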